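(* Let $E$ be a connected directed graph with spanning tree $T$, $v\in E^0$ and $c:E^1\to\Gamma$ a function where $\Gamma$ is a countable group. Then each connected component of $E\times_c\Gamma$ is isomorphic to $E\times_{c_{v,T}}\Gamma_v(c)$.
   Context: A directed graph $E$ consists of sets $E^0$ (vertices), $E^1$ (edges) and maps $r,s:E^1\to E^0$. For $e\in E^1$ let $e^{-1}$ be the formal reverse edge, with $s(e^{-1})=r(e)$, $r(e^{-1})=s(e)$, $(e^{-1})^{-1}=e$; $E^{-1}$ is the set of reverse edges. A walk is a sequence $a=a_1\cdots a_n$ with $a_i\in E^1\cup E^{-1}$ and $r(a_i)=s(a_{i+1})$; $s(a)=s(a_1)$, $r(a)=r(a_n)$ (vertices are trivial walks). It is reduced if it contains no subword $bb^{-1}$, $b\in E^1\cup E^{-1}$. The set $\pi_1(E)$ of reduced walks is a groupoid with unit space $E^0$: the product $a\cdot b$, defined when $r(a)=s(b)$, is concatenation followed by cancellation, and $(a_1\cdots a_n)^{-1}=a_n^{-1}\cdots a_1^{-1}$. For $v\in E^0$, $\pi_1(E,v)=\{a\in\pi_1(E):s(a)=v=r(a)\}$. $E$ is connected if there is a reduced walk between any two distinct vertices. A tree is a directed graph with precisely one reduced walk between any two vertices. A spanning tree of $E$ is a subgraph $T$ which is a tree with $T^0=E^0$. For a function $c:E^1\to\Gamma$ into a group, the skew product graph $E\times_c\Gamma$ has vertex set $E^0\times\Gamma$, edge set $E^1\times\Gamma$, $s(e,g)=(s(e),g)$ and $r(e,g)=(r(e),gc(e))$. The function $c$ extends to a functor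 $c:\pi_1(E)\to\Gamma$ by $c(a_1\cdots a_n)=c(a_1)\cdots c(a_n)$ with $c(e^{-1})=c(e)^{-1}$. The local voltage group of $c$ based at $v$ is the subgroup $\Gamma_v(c)=\{c(a):a\in\pi_1(E,v)\}$ of $\Gamma$. The $T$-voltage based at $v$ is the function $c_{v,T}(e)=c(b_{s(e)}eb_{r(e)}^{-1})=c(b_{s(e)})c(e)c(b_{r(e)})^{-1}$ for $e\in E^1$, where for $w\in E^0$, $b_w$ is the unique reduced walk in $T$ from $v$ to $w$; it takes values in $\Gamma_v(c)$ and in $E\times_{c_{v,T}}\Gamma_v(c)$ is regarded as a function $E^1\to\Gamma_v(c)$. *)

(* Defs.v *)
From HB Require Import structures.
From mathcomp Require Import all_boot all_classical.

Set Implicit Arguments.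
Unset Strict Implicit.
Unset Printing Implicit Defensive.

Local Open Scope group_scope.
Local Open Scope classical_set_scope.

Record digraph := Digraph {
  vert : Type;
  edge : Type;
  src : edge -> vert;
  rng : edge -> vert }.

Definition digraph_iso (E F : digraph) : Prop :=
  exists (f0 : vert E -> vert F) (f1 : edge E -> edge F),
    [/\ bijective f0, bijective f1,
        forall e, src (f1 e) = f0 (src e) &
        forall e, rng (f1 e) = f0 (rng e)].

Section Walks.
Variable E : digraph.

(* The elements of E^1 \cup E^{-1}. *)
Inductive dart := Fwd of edge E | Rev of edge E.

Definition dsrc (d : dart) : vert E :=
  match d with Fwd e => src e | Rev e => rng e end.
Definition drng (d : dart) : vert E :=
  match d with Fwd e => rng e | Rev e => src e end.
Definition dinv (d : dart) : dart :=
  match d with Fwd e => Rev e | Rev e => Fwd e end.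

(* The empty word is the trivial walk at u = w. *)
Fixpoint is_walk (u : vert E) (a : seq dart) (w : vert E) : Prop :=
  if a is d :: a' then dsrc d = u /\ is_walk (drng d) a' w else u = w.

Definition reduced (a : seq dart) : Prop :=
  forall p b q, a <> p ++ [:: b, dinv b & q].

(* The reduced walks from u to w: a hom-set of the groupoid pi_1(E); the
   isotropy group pi_1(E, v) is pi1 v v. *)
Record pi1 (u w : vert E) := Pi1 {
  word :> seq dart;
  word_walk : is_walk u word w;
  word_reduced : reduced word }.

Definition connected : Prop :=
  forall u w : vert E, u <> w -> inhabited (pi1 u w).

(* u = w is included, so a tree carries no reduced closed walk other than the
   trivial ones. *)
Definition is_tree : Prop :=
  forall u w : vert E, exists! a : pi1 u w, True.

Definition ccons (b : dart) (a : seq dart) : seq dart :=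
  if a is b' :: a' then if `[< b' = dinv b >] then a' else b :: a else [:: b].
Definition cancel_word (a : seq dart) : seq dart := foldr ccons [::] a.

Lemma dinvK : involutive dinv. Proof. by case. Qed.

Lemma dsrc_inv d : dsrc (dinv d) = drng d. Proof. by case: d. Qed.

Lemma drng_inv d : drng (dinv d) = dsrc d. Proof. by case: d. Qed.

Lemma ccons_walk b a w : is_walk (drng b) a w -> is_walk (dsrc b) (ccons b a) w.
Proof.
case: a => [|b' a] //= [h1 h2]; case: asboolP => [e|_] //=.
by rewrite -drng_inv -e.
Qed.

Lemma reduced_behead b a : reduced (b :: a) -> reduced a.
Proof. by move=> h p c q e; apply: (h (b :: p) c q); rewrite e. Qed.

Lemma ccons_reduced b a : reduced a -> reduced (ccons b a).
Proof.
case: a => [|b' a] /=; first by move=> _ [|? []].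
move=> h; case: asboolP => [_|ne]; first exact: reduced_behead h.
move=> [|x p] c q /=; first by case=> eb e _; apply: ne; rewrite eb.
by case=> _ e; apply: (h p c q).
Qed.

Lemma cancel_walk u a w : is_walk u a w -> is_walk u (cancel_word a) w.
Proof. by elim: a u => [|b a IH] u //= [<- /IH]; apply: ccons_walk. Qed.

Lemma cancel_reduced a : reduced (cancel_word a).
Proof. by elim: a => [|b a IH]; [case | apply: ccons_reduced]. Qed.

Lemma walk_cat u a x b w :
  is_walk u a x -> is_walk x b w -> is_walk u (a ++ b) w.
Proof. by elim: a u => [|d a IH] u /= => [->|[-> /IH h] /h]. Qed.

Lemma walk_rev u a w : is_walk u a w -> is_walk w (rev (map dinv a)) u.
Proof.
elim: a u => [|d a IH] u /= => [->|[<- /IH h]] //.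
rewrite rev_cons -cats1; apply: walk_cat h _.
by rewrite /= dsrc_inv drng_inv.
Qed.

Lemma reduced_rev a : reduced a -> reduced (rev (map dinv a)).
Proof.
move=> h p b q /(congr1 rev); rewrite revK => /(congr1 (map dinv)).
rewrite mapK; last exact: dinvK.
rewrite rev_cat !rev_cons -!cats1 -!catA !map_cat /= dinvK => e.
by apply: (h (map dinv (rev q)) b (map dinv (rev p))).
Qed.

Lemma reduced_nil : reduced [::]. Proof. by case. Qed.

Lemma reduced_one d : reduced [:: d]. Proof. by case=> [|? []]. Qed.

Definition pi1_unit (u : vert E) : pi1 u u :=
  @Pi1 u u [::] erefl reduced_nil.

Definition pi1_edge (e : edge E) : pi1 (src e) (rng e) :=
  @Pi1 (src e) (rng e) [:: Fwd e] (conj erefl erefl) (@reduced_one (Fwd e)).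

Definition pi1_mul (u x w : vert E) (a : pi1 u x) (b : pi1 x w) : pi1 u w :=
  @Pi1 u w (cancel_word (a ++ b))
    (cancel_walk (walk_cat (word_walk a) (word_walk b)))
    (@cancel_reduced (a ++ b)).

Definition pi1_inv (u w : vert E) (a : pi1 u w) : pi1 w u :=
  @Pi1 w u (rev (map dinv a)) (walk_rev (word_walk a))
    (reduced_rev (@word_reduced _ _ a)).

End Walks.

Section Subgraphs.
Variable E : digraph.

Record subgraph := Subgraph {
  sub_vert : set (vert E);
  sub_edge : set (edge E);
  sub_src : forall e, sub_edge e -> sub_vert (src e);
  sub_rng : forall e, sub_edge e -> sub_vert (rng e) }.

Definition graph_of (S : subgraph) : digraph :=
  @Digraph {u : vert E | sub_vert S u} {e : edge E | sub_edge S e}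
    (fun e => exist _ (src (sval e)) (sub_src (svalP e)))
    (fun e => exist _ (rng (sval e)) (sub_rng (svalP e))).

Definition subgraph_le (S S' : subgraph) : Prop :=
  sub_vert S `<=` sub_vert S' /\ sub_edge S `<=` sub_edge S'.

(* The connected components: the maximal nonempty connected subgraphs. *)
Definition is_component (S : subgraph) : Prop :=
  [/\ sub_vert S !=set0, connected (graph_of S) &
      forall S', connected (graph_of S') -> subgraph_le S S' ->
        subgraph_le S' S].

Definition spanning_tree (T : subgraph) : Prop :=
  is_tree (graph_of T) /\ sub_vert T = setT.

Definition dart_incl (S : subgraph) (d : dart (graph_of S)) : dart E :=
  match d with Fwd e => Fwd (sval e) | Rev e => Rev (sval e) end.

Lemma dart_incl_inv S (d : dart (graph_of S)) :
  dart_incl (dinv d) = dinv (dart_incl d).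
Proof. by case: d. Qed.

Lemma dart_incl_inj S : injective (@dart_incl S).
Proof.
by move=> [] [e he] [] [e' he'] //= [?]; subst e'; do 2 congr (_ _);
  apply: Prop_irrelevance.
Qed.

Lemma walk_incl S (u w : vert (graph_of S)) a :
  is_walk u a w -> is_walk (sval u) (map (@dart_incl S) a) (sval w).
Proof.
elim: a u => [|d a IH] u /= => [->|[<- /IH h]] //.
by split; [case: (d) | case: (d) h].
Qed.

Lemma reduced_incl S (a : seq (dart (graph_of S))) :
  reduced a -> reduced (map (@dart_incl S) a).
Proof.
elim: a => [|x a IH] h; first by case.
case=> [|y p] b q /=; last first.
  by case=> _; apply: IH; apply: reduced_behead h.
case: a {IH} h => [|z a] //= h [e1 e2 _].
apply: (h [::] x a) => /=; congr [:: _, _ & _].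
by apply: dart_incl_inj; rewrite dart_incl_inv e1.
Qed.

Definition pi1_incl (S : subgraph) (u w : vert (graph_of S)) (a : pi1 u w) :
    pi1 (sval u) (sval w) :=
  @Pi1 E (sval u) (sval w) (map (@dart_incl S) a)
    (walk_incl (word_walk a)) (reduced_incl (@word_reduced _ _ _ a)).

Section SpanningTree.
Variables (T : subgraph) (hT : spanning_tree T).

Definition tree_vert (u : vert E) : vert (graph_of T) :=
  exist _ u (eq_ind_r (fun A : set (vert E) => A u) I hT.2).

(* With v the base point, tree_walk v w is b_w. *)
Definition tree_walk (v w : vert E) : pi1 v w :=
  pi1_incl (sval (cid (hT.1 (tree_vert v) (tree_vert w)))).

End SpanningTree.

End Subgraphs.

Definition skew_product (E : digraph) (G : groupType) (c : edge E -> G) :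
    digraph :=
  @Digraph (vert E * G) (edge E * G)
    (fun eg => (src eg.1, eg.2)) (fun eg => (rng eg.1, eg.2 * c eg.1)).

Section Voltage.
Variables (E : digraph) (G : groupType) (c : edge E -> G).

Definition dvolt (d : dart E) : G :=
  match d with Fwd e => c e | Rev e => (c e)^-1 end.

Definition wvolt (a : seq (dart E)) : G := \prod_(d <- a) dvolt d.

Definition volt (u w : vert E) (a : pi1 u w) : G := wvolt a.

Lemma dvolt_inv d : dvolt (dinv d) = (dvolt d)^-1.
Proof. by case: d => e //=; rewrite invgK. Qed.

Lemma wvolt_ccons b a : wvolt (ccons b a) = dvolt b * wvolt a.
Proof.
case: a => [|b' a] /=; first by rewrite /wvolt big_cons.
case: asboolP => [->|_]; rewrite /wvolt !big_cons //.
by rewrite dvolt_inv mulVKg.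
Qed.

Lemma wvolt_cancel a : wvolt (cancel_word a) = wvolt a.
Proof.
elim: a => [|b a IH] //=; rewrite wvolt_ccons IH.
by rewrite /wvolt big_cons.
Qed.

Lemma volt_unit u : volt (pi1_unit u) = 1.
Proof. exact: big_nil. Qed.

Lemma volt_edge e : volt (pi1_edge e) = c e.
Proof. exact: big_seq1. Qed.

Lemma volt_mul u x w (a : pi1 u x) (b : pi1 x w) :
  volt (pi1_mul a b) = volt a * volt b.
Proof. by rewrite /volt wvolt_cancel /wvolt big_cat. Qed.

Lemma volt_inv u w (a : pi1 u w) : volt (pi1_inv a) = (volt a)^-1.
Proof.
rewrite /volt /=; elim: (word a) => [|d s IH] /=.
  by rewrite /wvolt big_nil invg1.
rewrite rev_cons -cats1 /wvolt big_cat big_seq1 big_cons invgM dvolt_inv.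
by congr (_ * _).
Qed.

Variable v : vert E.

Definition voltage_group : set G := [set volt a | a in [set: pi1 v v]].

Lemma voltage_group_closed :
  group_closed [pred g : G | g \in voltage_group].
Proof.
split; first by rewrite !inE; exists (pi1_unit v) => //; apply: volt_unit.
move=> x y; rewrite !inE => -[a _ <-] [b _ <-].
by exists (pi1_mul a (pi1_inv b)); rewrite // volt_mul volt_inv.
Qed.

Definition local_voltage := {g : G | g \in voltage_group}.

HB.instance Definition _ := SubChoice.on local_voltage.
HB.instance Definition _ :=
  SubChoice_isSubGroup.Build G _ local_voltage voltage_group_closed.

Definition T_voltage (T : subgraph E) (hT : spanning_tree T) (e : edge E) :
    local_voltage :=
  exist _
    (volt (pi1_mul (pi1_mul (tree_walk hT v (src e)) (pi1_edge e))
                   (pi1_inv (tree_walk hT v (rng e)))))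
    (mem_set (imageT _ _)).

Lemma val_T_voltage (T : subgraph E) (hT : spanning_tree T) e :
  val (T_voltage hT e) =
  volt (tree_walk hT v (src e)) * c e * (volt (tree_walk hT v (rng e)))^-1.
Proof. by rewrite /= 2!volt_mul volt_inv volt_edge. Qed.

End Voltage.

(* Main.v *)
Require Import Defs.
From mathcomp Require Import all_boot all_classical.

Set Implicit Arguments.
Unset Strict Implicit.
Unset Printing Implicit Defensive.

Local Open Scope group_scope.

(** Write [t w] for the voltage of the tree walk [b_w] from [v] to [w], [c']
for the [T]-voltage and [H] for the local voltage group at [v].  For a fixed
[k] in the group, give the vertex [(w, g)] of the skew product the coordinate
[k^-1 * g * (t w)^-1], and the edge [(e, g)] the coordinate of its source.
Since [c' e = t (s e) * c e * (t (r e))^-1], the coordinate of the range of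
[(e, g)] is that of its source times [c' e] ([coord_rng]); so [(w, g)] goes to
[(w, coordinate)] compatibly with the edges of the skew product by [c'].

It remains to see that a component consists exactly of the vertices and edges
whose coordinate is in [H], where [k = g0 * (t u0)^-1] is chosen so that some
vertex [(u0, g0)] of the component has coordinate [1].  These vertices and
edges form a subgraph.  It contains the component because membership of the
coordinate in [H] is invariant along walks ([coord_walk]).  It is connected
because two vertices [(w, g)] and [(w', g')] whose coordinates differ by the
voltage of a closed walk [a] at [v] are joined by the lift of
[b_w^-1 a b_w'] ([coset_subgraph_connected]).  By maximality the two are
equal. *)

(** * Reduced walks and connectedness *)

Lemma walk_pi1 (E : digraph) (u w : vert E) a :
  is_walk u a w -> inhabited (pi1 u w).
Proof.
move=> h; exact: (inhabits (Pi1 (cancel_walk h) (@cancel_reduced _ a))).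
Qed.

Lemma connected_walk (E : digraph) : connected E ->
  forall u w : vert E, exists a, is_walk u a w.
Proof.
move=> hE u w; case: (pselect (u = w)) => [->|/hE [a]]; first by exists [::].
by exists a; apply: word_walk.
Qed.

(** * The local voltage group *)

Section VoltageGroup.
Variables (E : digraph) (G : groupType) (c : edge E -> G) (v : vert E).
Local Notation H := (voltage_group c v).

Lemma voltage_group1 : H 1.
Proof. by exists (pi1_unit v) => //; apply: volt_unit. Qed.

Lemma voltage_groupM x y : H x -> H y -> H (x * y).
Proof.
by move=> [a _ <-] [b _ <-]; exists (pi1_mul a b) => //; apply: volt_mul.
Qed.

Lemma voltage_groupV x : H x -> H x^-1.
Proof. by move=> [a _ <-]; exists (pi1_inv a) => //; apply: volt_inv. Qed.

Lemma voltage_groupMr x y : H y -> H (x * y) <-> H x.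
Proof.
move=> hy; split=> [hxy|hx]; last exact: voltage_groupM.
by rewrite -(mulgK y x); apply: voltage_groupM => //; apply: voltage_groupV.
Qed.

End VoltageGroup.

(** * Coordinates on the skew product *)

Section Coset.
Variables (E : digraph) (T : subgraph E) (hT : spanning_tree T) (v : vert E).
Variables (G : groupType) (c : edge E -> G) (k : G).
Local Notation H := (voltage_group c v).
Local Notation t w := (volt c (tree_walk hT v w)).

(** The coordinate of the vertex [(w, g)] relative to the base value [k]. *)
Definition coord (w : vert E) (g : G) : G := k^-1 * g * (t w)^-1.

Lemma coordK w : cancel (coord w) (fun h => k * h * t w).
Proof. by move=> g; rewrite /coord !mulgA mulgV mul1g mulgVK. Qed.

Lemma coordVK w : cancel (fun h => k * h * t w) (coord w).
Proof. by move=> h; rewrite /coord !mulgA mulVg mul1g mulgK. Qed.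

Lemma coord_rng e g :
  coord (rng e) (g * c e) = coord (src e) g * val (T_voltage c v hT e).
Proof. by rewrite val_T_voltage /coord !mulgA mulgVK. Qed.

Lemma coord_edge e g : H (coord (rng e) (g * c e)) <-> H (coord (src e) g).
Proof.
rewrite coord_rng; apply: voltage_groupMr.
exact: set_mem (svalP (T_voltage c v hT e)).
Qed.

Lemma coord_walk (x y : vert (skew_product c)) a :
  is_walk x a y -> H (coord x.1 x.2) -> H (coord y.1 y.2).
Proof.
elim: a x => [|d a IH] x /= => [->//|[<- /IH h] hx]; apply: h.
by case: d hx => -[e g] /= /coord_edge.
Qed.

(** The part of the skew product whose coordinates lie in the local voltage
group. *)
Definition coset_subgraph : subgraph (skew_product c) :=
  @Subgraph (skew_product c)
    [set x | H (coord x.1 x.2)]%classic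
    [set x | H (coord (src x.1) x.2)]%classic
    (fun _ h => h) (fun x h => proj2 (coord_edge x.1 x.2) h).

(** Path lifting: a walk in [E] lifts to the coset
subgraph from any vertex above its source. *)
Lemma lift_walk (w w' : vert E) a g
    (hg : sub_vert coset_subgraph (w, g)) :
  is_walk w a w' ->
  exists hg' : sub_vert coset_subgraph (w', g * wvolt c a),
  exists b, is_walk (E := graph_of coset_subgraph)
    (exist _ (w, g) hg) b (exist _ (w', g * wvolt c a) hg').
Proof.
elim: a w g hg => [|d a IH] w g hg /=.
  move=> ?; subst w'; rewrite /wvolt big_nil mulg1.
  by exists hg, [::].
case=> hd ha; subst w.
rewrite /wvolt big_cons mulgA -/(wvolt c a).
case: d hg ha => e /= hg ha.
  have hr : sub_vert coset_subgraph (rng e, g * c e) by apply/coord_edge.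
  have [hg' [b hb]] := IH _ _ hr ha.
  exists hg', (Fwd (E := graph_of coset_subgraph) (exist _ (e, g) hg) :: b).
  split; first by apply: eq_exist.
  by move: hb; congr (is_walk _ _ _); apply: eq_exist.
(* A reverse edge starting at height g is the reverse of the edge whose source
   has height g * (c e)^-1. *)
have hr : sub_vert coset_subgraph (src e, g * (c e)^-1).
  by apply/coord_edge; rewrite mulgVK.
have [hg' [b hb]] := IH _ _ hr ha.
exists hg', (Rev (E := graph_of coset_subgraph)
               (exist _ (e, g * (c e)^-1) hr) :: b).
split; first by apply: eq_exist; rewrite /= mulgVK.
by move: hb; congr (is_walk _ _ _); apply: eq_exist.
Qed.

Lemma coset_subgraph_connected : connected (graph_of coset_subgraph).
Proof.
move=> [[w g] hg] [[w' g'] hg'] _.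
have [a _ ea] : H ((coord w g)^-1 * coord w' g').
  by apply: voltage_groupM => //; apply: voltage_groupV.
pose p := pi1_mul (pi1_mul (pi1_inv (tree_walk hT v w)) a) (tree_walk hT v w').
have ep : g * wvolt c p = g'.
  have -> : wvolt c p = volt c p by [].
  rewrite 2!volt_mul volt_inv ea /coord !invgM !invgK !mulgA.
  by rewrite !mulgVK mulgV mul1g mulgV mul1g.
have [hr [b hb]] := lift_walk hg (word_walk p).
apply: (@walk_pi1 _ _ _ b); move: hb; congr (is_walk _ _ _).
by apply: eq_exist; rewrite ep.
Qed.

(** A component with a vertex of coordinate in the local voltage group is the
whole coset subgraph. *)
Lemma component_coset (C : subgraph (skew_product c)) x0 :
  is_component C -> sub_vert C x0 -> H (coord x0.1 x0.2) ->
  (forall x, sub_vert C x <-> H (coord x.1 x.2)) /\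
  (forall x, sub_edge C x <-> H (coord (src x.1) x.2)).
Proof.
move=> [_ hC hmax] hx0 h0.
have sub_v x : sub_vert C x -> H (coord x.1 x.2).
  move=> hx; have [a ha] := connected_walk hC (exist _ x0 hx0) (exist _ x hx).
  exact: coord_walk (walk_incl ha) h0.
have sub_e x : sub_edge C x -> H (coord (src x.1) x.2).
  by move=> /(@sub_src _ C) /sub_v.
have [hv he] := hmax _ coset_subgraph_connected (conj sub_v sub_e).
by split=> x; split; [exact: sub_v | exact: hv | exact: sub_e | exact: he].
Qed.

(** The isomorphism: a vertex or an edge is determined by its projection to
[E] together with its coordinate. *)
Lemma coset_iso (C : subgraph (skew_product c)) :
  (forall x, sub_vert C x <-> H (coord x.1 x.2)) ->
  (forall x, sub_edge C x <-> H (coord (src x.1) x.2)) ->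
  digraph_iso (graph_of C) (skew_product (T_voltage c v hT)).
Proof.
move=> hv he.
pose inH h (hh : H h) : local_voltage c v :=
  exist (fun g : G => g \in H) h (mem_set hh).
pose f0 (x : vert (graph_of C)) : vert (skew_product (T_voltage c v hT)) :=
  ((sval x).1, inH _ (proj1 (hv (sval x)) (svalP x))).
pose f1 (x : edge (graph_of C)) : edge (skew_product (T_voltage c v hT)) :=
  ((sval x).1, inH _ (proj1 (he (sval x)) (svalP x))).
have Hval (w : vert E) (h : local_voltage c v) : H (coord w (k * val h * t w)).
  by rewrite coordVK; apply/set_mem/(valP h).
pose g0 (x : vert (skew_product (T_voltage c v hT))) : vert (graph_of C) :=
  exist _ (x.1, k * val x.2 * t x.1) (proj2 (hv (_, _)) (Hval x.1 x.2)).
pose g1 (x : edge (skew_product (T_voltage c v hT))) : edge (graph_of C) :=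
  exist _ (x.1, k * val x.2 * t (src x.1))
    (proj2 (he (_, _)) (Hval (src x.1) x.2)).
exists f0, f1; split.
- exists g0 => [[[w g] hx]|[w h]].
    by apply: eq_exist; rewrite /= coordK.
  by congr (_, _); apply: val_inj; rewrite /= coordVK.
- exists g1 => [[[e g] hx]|[e h]].
    by apply: eq_exist; rewrite /= coordK.
  by congr (_, _); apply: val_inj; rewrite /= coordVK.
- by move=> [[e g] hx]; congr (_, _); apply: val_inj.
- move=> [[e g] hx]; congr (_, _); apply: val_inj.
  exact: esym (coord_rng e g).
Qed.

End Coset.

Theorem proposition5p10
  (E : digraph) (T : subgraph E) (v : vert E) (G : groupType) (c : edge E -> G)
  (E_connected : connected E) (T_spanning : spanning_tree T)
  (G_countable : countable [set: G]%classic)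
  (C : subgraph (skew_product c)) (C_component : is_component C) :
  digraph_iso (graph_of C) (skew_product (T_voltage c v T_spanning)).
Proof.
have [[[u0 g0] hx0] _ _] := C_component.
pose k := g0 * (volt c (tree_walk T_spanning v u0))^-1.
have h0 : voltage_group c v (coord T_spanning v c k u0 g0).
  by rewrite /coord -mulgA mulVg; apply: voltage_group1.
have [hv he] := component_coset C_component hx0 h0.
exact: coset_iso hv he.
Qed.
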